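(* Let $G$ be a 2-degenerate graph and let $F:V(G)\to 2^{\mathbb{N}}$ with $|F(v)|<\tfrac{1}{2}d(v)$ for all $v\in V(G)$. Then $G$ has an $F$-avoiding orientation.
   Context: All graphs are finite and loopless; parallel edges are permitted, and the degree $d(v)$ of a vertex $v$ of $G$ counts edges with multiplicity. A graph is 2-degenerate if every subgraph of it contains a vertex of degree at most $2$ (in that subgraph). $\mathbb{N}$ includes $0$, and $2^{\mathbb{N}}$ is the set of all subsets of $\mathbb{N}$. An orientation $D$ of $G$ assigns a direction to each edge, so that each edge points out of one endpoint and into the other; $d_D^+(v)$ is the number of edges pointing out of $v$. The orientation $D$ is $F$-avoiding if $d_D^+(v)\notin F(v)$ for all $v\in V(G)$. *)

(* Defs.v *)
From mathcomp Require Import all_boot.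
From mathcomp Require Import finmap.
From mathcomp Require Import classical_sets cardinality.

Set Implicit Arguments.
Unset Strict Implicit.
Unset Printing Implicit Defensive.

(* Parallel edges are distinct elements of [edge] with the same [ends];
   two-element ends rule out loops. *)
Record multigraph := Multigraph {
  vertex : finType;
  edge : finType;
  ends : edge -> {set vertex};
  card_ends : forall e, #|ends e| = 2
}.

Definition degree_in (G : multigraph) (B : {set edge G}) (v : vertex G) : nat :=
  #|[set e in B | v \in ends e]%SET|.

Definition degree (G : multigraph) (v : vertex G) : nat :=
  degree_in [set: edge G]%SET v.

Definition is_subgraph (G : multigraph)
    (W : {set vertex G}) (B : {set edge G}) : Prop :=
  forall e, e \in B -> ends e \subset W.

(* As usual, the subgraph with no vertices is excluded: it would make the
   condition fail for every graph. *)
Definition degenerate (k : nat) (G : multigraph) : Prop :=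
  forall (W : {set vertex G}) (B : {set edge G}),
    is_subgraph W B -> (W != finset.set0) ->
    exists2 v, v \in W & degree_in B v <= k.

Record orientation (G : multigraph) := Orientation {
  source : edge G -> vertex G;
  target : edge G -> vertex G;
  ends_orientation : forall e, ends e = [set source e; target e]%SET
}.

Definition outdegree (G : multigraph) (D : orientation G) (v : vertex G) : nat :=
  #|[set e | source D e == v]%SET|.

Definition avoiding (G : multigraph) (F : vertex G -> set nat)
    (D : orientation G) : Prop :=
  forall v, ~ F v (outdegree D v).

(* [fset_set A] is empty when [A] is infinite, hence the explicit finiteness. *)
Definition card_lt_half (A : set nat) (d : nat) : Prop :=
  finite_set A /\ 2 * #|` fset_set A| < d.

(* Main.v *)
Require Import Defs.
From mathcomp Require Import all_boot.
From mathcomp Require Import finmap.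
From mathcomp Require Import classical_sets cardinality.

(** The vertices can be served greedily, in the reverse of the order in which
    2-degeneracy peels them off.  When the turn of [v] comes, at most two of
    its edges lead to vertices already served; the others, at least
    [degree v - 2] of them, can still be oriented at will, and reorienting
    them leaves the outdegree of every served vertex unchanged.  With [k] such
    edges the outdegree of [v] can be made any of [k + 1] consecutive numbers
    ([adjust_outdegree]), and one of these lies outside [F v] as soon as
    [#|F v| <= k] ([exists_avoiding_shift]).  This inequality follows from
    [2 #|F v| < degree v]: if [degree v <= 2] then [F v] is empty, and
    otherwise [(degree v - 1) / 2 <= degree v - 2].

    The induction ([serve_set]) is on the set [W] of served vertices: the
    vertex of small degree in the subgraph induced by [W] is the one served
    last within [W]. *)

Lemma orientation_of_source {G : multigraph} {s : edge G -> vertex G} :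
  (forall e, s e \in ends e) ->
  exists D : orientation G, source D =1 s.
Proof.
move=> sP.
have other e : {t | ends e = [set s e; t]%SET}.
  suff /sigW[t /eqP et] : exists t, ends e == [set s e; t]%SET by exists t.
  have /eqP/cards2P[x [y [_ exy]]] := card_ends e.
  have := sP e; rewrite exy !inE => /orP[]/eqP->; first by exists y.
  by exists x; rewrite finset.setUC.
by exists (Orientation (fun e => svalP (other e))).
Qed.

Lemma source_in_ends (G : multigraph) (D : orientation G) e :
  source D e \in ends e.
Proof. by rewrite (ends_orientation D) !inE eqxx. Qed.

Lemma other_endP (G : multigraph) (e : edge G) (v : vertex G) :
  exists2 w, w \in ends e & w != v.
Proof.
have /eqP/cards2P[x [y [nxy ->]]] := card_ends e.
have [xv | nxv] := eqVneq x v; last by exists x; rewrite ?inE ?eqxx.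
by exists y; rewrite ?inE ?eqxx ?orbT // eq_sym -xv.
Qed.

Lemma orientation_exists (G : multigraph) : inhabited (orientation G).
Proof.
have end_of (e : edge G) : {w | w \in ends e}.
  by apply: sigW; apply/set0Pn; rewrite -card_gt0 card_ends.
by have [D _] := orientation_of_source (fun e => svalP (end_of e)).
Qed.

Lemma exists_subset_card {T : finType} {A : {set T}} {j} :
  j <= #|A| -> exists2 B : {set T}, B \subset A & #|B| = j.
Proof.
move=> jA; suff: 0 < #|[set B : {set T} | B \subset A & #|B| == j]%SET|.
  by case/card_gt0P=> B; rewrite inE => /andP[BA /eqP]; exists B.
by rewrite cards_draws bin_gt0.
Qed.

(** [K] consists of the edges at [v] that are still free; [b], the outdegree
    that [v] gets from its remaining edges, is therefore the same for all
    reorientations of [K]. *)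
Lemma adjust_outdegree {G : multigraph} (D : orientation G) {v : vertex G}
    {K : {set edge G}} :
  (forall e, e \in K -> v \in ends e) ->
  exists b, forall j, j <= #|K| ->
    exists D' : orientation G,
      (forall e, e \notin K -> source D' e = source D e)
      /\ outdegree D' v = b + j.
Proof.
move=> Kv; exists #|[set e | source D e == v] :\: K|%SET => j jK.
have [S SK cardS] := exists_subset_card jK.
have away (e : edge G) : {w | (w \in ends e) && (w != v)}.
  by apply: sigW; have [w we wv] := other_endP _ e v; exists w; rewrite we.
pose s e := if e \in K then if e \in S then v else sval (away e)
            else source D e.
have sP e : s e \in ends e.
  rewrite /s; case: ifP => [/Kv ve|_]; last exact: source_in_ends.
  by case: ifP => // _; have /andP[] := svalP (away e).
have [D' D's] := orientation_of_source sP.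
exists D'; split=> [e eK|]; first by rewrite D's /s (negPf eK).
rewrite -cardS /outdegree -(cardsID K) addnC; congr (_ + _).
  apply: eq_card => e; rewrite !inE D's /s.
  by case: (e \in K) => //=.
apply: eq_card => e; rewrite !inE D's /s.
case: ifP => [_|/negbT eK]; last first.
  by rewrite andbF; apply/esym/negbTE; apply: contra eK; apply/fintype.subsetP.
case: ifP => _; rewrite andbT ?eqxx //.
by have /andP[_ /negbTE] := svalP (away e).
Qed.

(** Pigeonhole: the [k + 1] candidates [b, ..., b + k] do not all fit in [A]. *)
Lemma exists_avoiding_shift {A : set nat} b {k} :
  finite_set A -> #|` fset_set A| <= k ->
  exists2 j, j <= k & ~ A (b + j).
Proof.
move=> finA Ak.
have [/allP sub | /allPn[j]] :=
  boolP (all (fun j => b + j \in fset_set A) (iota 0 k.+1)); last first.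
  rewrite mem_iota ltnS => jk bjA; exists j => // Abj.
  by move: bjA; rewrite in_fset_set // mem_set.
suff: k.+1 <= #|` fset_set A| by rewrite leqNgt ltnS Ak.
rewrite -[X in X <= _](size_iota 0) -(size_map (addn b)).
apply: uniq_leq_size; first by rewrite map_inj_uniq ?iota_uniq //; apply: addnI.
by move=> _ /mapP[j /sub jA ->].
Qed.

(** An edge joining [v] in [W] to a vertex outside [W] contributes to the
    outdegree of no other vertex of [W].  Hence [v] can be served after the
    rest of [W] by reorienting such edges only. *)
Lemma serve_set {G : multigraph} {F : vertex G -> set nat} :
    degenerate 2 G -> (forall v, card_lt_half (F v) (degree v)) ->
  forall W : {set vertex G},
  exists D : orientation G, forall v, v \in W -> ~ F v (outdegree D v).
Proof.
move=> hG hF W; move: {2}#|W| (erefl #|W|) => n.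
elim: n W => [|n IHn] W cardW.
  have [D] := orientation_exists G; exists D => v.
  by rewrite (cards0_eq cardW) inE.
pose B := [set e : edge G | ends e \subset W]%SET.
have [||v vW degv] := hG W B; first by move=> e; rewrite inE.
  by rewrite -card_gt0 cardW.
have [|D DF] := IHn (W :\ v)%SET.
  by apply/eqP; rewrite -eqSS -cardW (cardsD1 v W) vW.
pose K := [set e | v \in ends e & ~~ (ends e \subset W)]%SET.
have degE : degree v = degree_in B v + #|K|.
  rewrite /degree /degree_in -(cardsID B); congr (_ + _);
  by apply: eq_card => e; rewrite !inE andbC.
have [finF Fdeg] := hF v.
have FK : #|` fset_set (F v)| <= #|K|.
  (* An empty [F v] covers [degree v <= 2]; otherwise [degree v >= 3]. *)
  have [->//|Fpos] := posnP #|` fset_set (F v)|.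
  rewrite -(leq_add2l 2); apply: leq_trans (_ : degree v <= _).
    apply: leq_trans Fdeg.
    by rewrite mul2n -addnn !addSn !ltnS add0n -add1n leq_add2r.
  by rewrite degE leq_add2r.
have Kv e : e \in K -> v \in ends e by rewrite inE => /andP[].
have [b adjust] := adjust_outdegree D Kv.
have [j jK Fj] := exists_avoiding_shift b finF FK.
have [D' [D'K outv]] := adjust j jK.
exists D' => u uW; have [->|uv] := eqVneq u v; first by rewrite outv.
suff -> : outdegree D' u = outdegree D u by apply: DF; rewrite !inE uv.
apply: eq_card => e; rewrite !inE.
have [eK|/D'K->//] := boolP (e \in K).
(* An edge of [K] joins [v] to a vertex outside [W], so it misses [u]. *)
have ue : u \notin ends e.
  move: eK; rewrite inE => /andP[ve]; apply: contra => ue.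
  have -> : ends e = [set u; v]%SET.
    apply/esym/eqP; rewrite eqEcard card_ends cards2 uv andbT.
    by apply/fintype.subsetP=> x; rewrite !inE => /orP[]/eqP->.
  by apply/fintype.subsetP=> x; rewrite !inE => /orP[]/eqP->.
by rewrite !(introF eqP) // => su; move: ue; rewrite -su source_in_ends.
Qed.

Theorem theorem4 (G : multigraph) (F : vertex G -> set nat)
    (hG : degenerate 2 G)
    (hF : forall v : vertex G, card_lt_half (F v) (degree v)) :
  exists D : orientation G, avoiding F D.
Proof.
have [D DF] := serve_set hG hF [set: vertex G]%SET.
by exists D => v; apply: DF; rewrite inE.
Qed.
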